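(* Let $n\ge 5$ be an integer. Then the set $$T_1(n)=\{(k,n):1\le k\le n-1\}$$ of transpositions is the unique maximum clique in $G(\mathcal{C}_n(2))$ up to permutation similarity.
   Context: $\mathrm{Sym}(n)$ is the symmetric group on $[n]=\{1,\dots,n\}$. A cycle means a permutation $(i_1,\dots,i_k)$ of length $k>1$, sending $i_j\mapsto i_{j+1}$ for $1\le j\le k-1$, $i_k\mapsto i_1$, and fixing everything else. The Birkhoff polytope graph $G(\Omega_n)$ has vertex set $\mathrm{Sym}(n)$, and $\sigma_1,\sigma_2$ are adjacent iff $\sigma_1^{-1}\sigma_2$ is a (single) cycle of length $>1$. $\mathcal{C}_n(k)$ is the set of all cycles of length $k$ in $\mathrm{Sym}(n)$, and $G(\mathcal{C}_n(k))$ is the subgraph of $G(\Omega_n)$ induced by $\mathcal{C}_n(k)$. A clique is a set of pairwise adjacent vertices; a maximum clique is a clique of largest size. Two subsets $K,L\subseteq\mathrm{Sym}(n)$ are equal up to permutation similarity if $L=\pi K\pi^{-1}$ for some $\pi\in\mathrm{Sym}(n)$. *)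

(* Defs.v *)
From mathcomp Require Import all_boot all_fingroup.

Set Implicit Arguments.
Unset Strict Implicit.
Unset Printing Implicit Defensive.

Record graph (T : finType) := Graph {
  vertices : {set T};
  adjacent : T -> T -> Prop
}.

Definition induced (T : finType) (G : graph T) (S : {set T}) : graph T :=
  Graph (vertices G :&: S)
        (fun x y => [/\ x \in S, y \in S & adjacent G x y]).

Definition clique (T : finType) (G : graph T) (K : {set T}) : Prop :=
  K \subset vertices G /\
  {in K &, forall x y, x != y -> adjacent G x y}.

Definition maximum_clique (T : finType) (G : graph T) (K : {set T}) : Prop :=
  clique G K /\ forall L : {set T}, clique G L -> #|L| <= #|K|.

(* The cycle (i_1, ..., i_k) is [next c] for the duplicate-free tuple
   c = (i_1, ..., i_k): [next c] is cyclic on c and fixes every point not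
   in c. *)
Definition kcycles (n k : nat) : {set 'S_n} :=
  [set s : 'S_n | (1 < k) &&
     [exists c : k.-tuple 'I_n, uniq c && [forall x, s x == next c x]]].

(* MathComp composes permutations from left to right. The choice of convention
   is immaterial here: s1^-1 * s2 and s2 * s1^-1 are conjugate, hence have the
   same cycle type. *)
Definition birkhoff_graph (n : nat) : graph 'S_n :=
  Graph [set: 'S_n]
        (fun s1 s2 => exists k : nat, (s1^-1 * s2)%g \in kcycles n k).

Definition perm_similar (n : nat) (K L : {set 'S_n}) : Prop :=
  exists p : 'S_n, L = [set (p * s * p^-1)%g | s in K].

(* The points of [n] are numbered from 0: the point n is the ordinal n.-1. *)
Definition T1 (n : nat) : {set 'S_n} :=
  [set tperm i j | i in [set i : 'I_n | i < n.-1],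
                   j in [set j : 'I_n | j == n.-1 :> nat]].

(* Main.v *)
Require Import Defs.
From mathcomp Require Import all_boot all_fingroup.

(** A transposition is an edge of the complete graph on [n], and two distinct
transpositions are adjacent exactly when these edges share an endpoint: if
they do, the product is a 3-cycle; if they do not, it is a product of two
disjoint transpositions, which is not a single cycle because it moves points
lying in different orbits ([clique2_meet]).  A clique is therefore a family of
pairwise intersecting edges, and such a family is either contained in a star
or contained in a triangle ([clique2_dichotomy]).  A star has n - 1 >= 4 edges
([card_star]) and a triangle only 3, so the maximum cliques are exactly the
full stars; these are permuted transitively by conjugation ([conj_star]), and
[T1 n] is the star centred at the last point ([T1_star]). *)

Section Stars.

Variable n : nat.
Implicit Types (a b c x y : 'I_n) (s t : 'S_n) (K : {set 'S_n}).

Local Notation graph2 := (induced (birkhoff_graph n) (kcycles n 2)).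

Definition star c : {set 'S_n} := [set tperm j c | j in [set~ c]].

Lemma card_star c : #|star c| = n.-1.
Proof.
rewrite card_imset; first by rewrite cardsC1 card_ord.
by move=> i j /(congr1 (fun s : 'S_n => s c)); rewrite !tpermR.
Qed.

Lemma T1_star c : c = n.-1 :> nat -> T1 n = star c.
Proof.
move=> c_last; apply/setP=> s; apply/imset2P/imsetP.
  case=> i j; rewrite !inE => lt_i /eqP j_last ->.
  have -> : j = c by apply: val_inj; rewrite /= c_last.
  exists i; rewrite // !inE; apply: contraTneq lt_i => ->.
  by rewrite c_last ltnn.
case=> i; rewrite !inE => ne_ic ->; exists i c; rewrite ?inE ?c_last //.
have lt_in := ltn_ord i; have n_gt0 : 0 < n by apply: leq_trans lt_in.
rewrite ltn_neqAle -ltnS prednK // lt_in andbT -c_last.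
by apply: contraNneq ne_ic => /val_inj ->.
Qed.

Lemma conj_star (p : 'S_n) c :
  [set (p * s * p^-1)%g | s in star (p c)] = star c.
Proof.
have conjE j : (p * tperm (p j) (p c) * p^-1)%g = tperm j c.
  by rewrite -tpermJ conjgE !mulgA mulgV mul1g mulgK.
apply/setP=> s; apply/imsetP/imsetP.
  case=> _ /imsetP[j ne_j ->] ->; exists ((p^-1)%g j).
    by move: ne_j; rewrite !inE -{1}[j](permKV p) (inj_eq perm_inj).
  by rewrite -conjE permKV.
case=> j ne_j ->; exists (tperm (p j) (p c)); last by rewrite conjE.
by apply: imset_f; move: ne_j; rewrite !inE (inj_eq perm_inj).
Qed.

Lemma kcycles2P s :
  reflect (exists a b, a != b /\ s = tperm a b) (s \in kcycles n 2).
Proof.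
have nextE a b x : next [:: a; b] x = tperm a b x by rewrite permE.
rewrite inE /=; apply: (iffP existsP).
  case=> -[[|a [|b []]] //= sz]; rewrite inE andbT.
  case/andP=> ne_ab /forallP s_next; exists a, b; split=> //.
  by apply/permP=> x; rewrite (eqP (s_next x)) -nextE.
case=> a [b [ne_ab ->]]; exists [tuple a; b]; rewrite /= inE ne_ab /=.
by apply/forallP=> x; rewrite -nextE.
Qed.

(** A transposition has only two moved points, hence is determined by them. *)
Lemma kcycles2_eq s x y :
  s \in kcycles n 2 -> s x != x -> s y != y -> x != y -> s = tperm x y.
Proof.
case/kcycles2P=> a [b [_ ->]].
case: tpermP => [->|->|]; rewrite ?eqxx // => _.
  by case: tpermP => [->|->|]; rewrite ?eqxx.
by case: tpermP => [->|->|]; rewrite ?eqxx // tpermC.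
Qed.

(** A cycle acts transitively on the points it moves, so an invariant set
that contains one moved point contains them all. *)
Lemma kcycles_moved k s (A : {set 'I_n}) x y :
    s \in kcycles n k -> (forall z, z \in A -> s z \in A) ->
  x \in A -> s x != x -> s y != y -> y \in A.
Proof.
rewrite inE => /andP[_ /existsP[c /andP[Uc /forallP s_next]]] stabA Ax.
have sE z : s z = next c z by apply/eqP.
have moved_in z : s z != z -> z \in c.
  by apply: contraNT => c'z; rewrite sE next_nth (negPf c'z).
move=> /moved_in cx /moved_in cy.
have: fconnect (next c) x y by rewrite (fconnect_cycle (cycle_next Uc)).
move/iter_findex=> <-.
by elim: (findex _ _ _) => //= i IHi; rewrite -sE stabA.
Qed.

Lemma star_sub c : star c \subset kcycles n 2.
Proof.
apply/subsetP=> s /imsetP[j]; rewrite in_setC1 => ne_jc ->.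
by apply/kcycles2P; exists j, c.
Qed.

Lemma star_clique c : clique graph2 (star c).
Proof.
split; first by rewrite /= setTI star_sub.
move=> s t Ss St ne_st; split; try exact: (subsetP (star_sub c)).
case/imsetP: Ss St ne_st => a ac -> /imsetP[b bc ->].
move: ac bc; rewrite !inE => ne_ac ne_bc.
have [-> | ne_ab _] := eqVneq a b; first by rewrite eqxx.
(* Composing from left to right, (a c)(b c) sends a to b, b to c, c to a. *)
exists 3; rewrite inE /= tpermV; apply/existsP; exists [tuple a; b; c].
rewrite /= !inE negb_or ne_ab ne_ac ne_bc /=; apply/forallP=> x.
rewrite permM.
case: (tpermP a c x) => [->|->|/eqP ne_xa /eqP ne_xc].
- by rewrite eqxx tpermR.
- by rewrite ![c == _]eq_sym (negPf ne_ac) (negPf ne_bc) eqxx tpermD // eq_sym.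
rewrite (negPf ne_xa) (negPf ne_xc).
have [->|ne_xb] := eqVneq x b; first by rewrite tpermL.
by rewrite tpermD // eq_sym.
Qed.

Lemma clique2_sub K : clique graph2 K -> {subset K <= kcycles n 2}.
Proof. by case=> /= /subsetP subK _ s /subK; rewrite setTI. Qed.

(** If the edge [t] missed both ends of the edge [a b], then [{a, b}] would be
invariant under the product, which moves [a] and also the ends of [t]; so the
product would not be a single cycle. *)
Lemma clique2_meet K a b t :
    clique graph2 K -> tperm a b \in K -> a != b -> t \in K ->
  t a != a \/ t b != b.
Proof.
move=> cliqueK Kab ne_ab Kt; have := clique2_sub _ cliqueK _ Kt.
have [->|ne_t] := eqVneq t (tperm a b).
  by left; rewrite tpermL eq_sym.
case/kcycles2P=> c [d [ne_cd t_cd]].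
have [ta|] := eqVneq (t a) a; last by left.
have [tb|] := eqVneq (t b) b; last by right.
have [_ adj] := cliqueK.
case: (adj _ _ Kab Kt); first by rewrite eq_sym.
move=> _ _ [k]; rewrite tpermV => cyc.
have tc : t c = d by rewrite t_cd tpermL.
have ne_ca : c != a by apply: contra_neq ne_cd => ca; rewrite -tc ca ta.
have ne_cb : c != b by apply: contra_neq ne_cd => cb; rewrite -tc cb tb.
suff: c \in [set a; b] by rewrite !inE (negPf ne_ca) (negPf ne_cb).
apply: (kcycles_moved k _ _ a c cyc).
- move=> z; rewrite !inE permM => /orP[]/eqP->.
    by rewrite tpermL tb eqxx orbT.
  by rewrite tpermR ta eqxx.
- by rewrite !inE eqxx.
- by rewrite permM tpermL tb eq_sym.
by rewrite permM tpermD 1?eq_sym // tc.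
Qed.

(** Any two distinct edges of the clique have the form [a b] and [a c].  If [a]
is not on every edge, then an edge avoiding [a] must be [b c], and only the
sides of the triangle [a b c] meet all three of these edges. *)
Lemma clique2_dichotomy K :
  clique graph2 K -> #|K| <= 3 \/ exists c, K \subset star c.
Proof.
move=> cliqueK; have K2 := clique2_sub _ cliqueK.
have meet a b t := clique2_meet K a b t cliqueK.
have [le1|] := leqP #|K| 1; first by left; apply: leq_trans le1 _.
case/card_gt1P=> s [t [Ks Kt ne_st]].
have [a [b [c [ne_ab ne_ac ne_bc Kab Kac]]]] : exists a b c,
    [/\ a != b, a != c, b != c, tperm a b \in K & tperm a c \in K].
  have /kcycles2P[a [b [ne_ab s_ab]]] := K2 s Ks.
  have Kab : tperm a b \in K by rewrite -s_ab.
  (* [t] meets [s] at one end [x]; its other end is [t x], which differs from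
     both ends of [s] because the two edges are distinct. *)
  have other x y : x != y -> s = tperm x y -> t x != x ->
      [/\ x != t x, y != t x & tperm x (t x) \in K].
    move=> ne_xy s_xy tx; have t_x : t = tperm x (t x).
      apply: (kcycles2_eq _ _ _ (K2 t Kt) tx); last by rewrite eq_sym.
      by rewrite (inj_eq perm_inj).
    split; [by rewrite eq_sym | | by rewrite -t_x].
    by apply: contra_neq ne_st => y_tx; rewrite s_xy y_tx -t_x.
  case: (meet a b t Kab ne_ab Kt) => [ta|tb].
    by exists a, b, (t a); case: (other a b ne_ab s_ab ta).
  exists b, a, (t b).
  have ne_ba : b != a by rewrite eq_sym.
  have [|ne_b ne_a Kb] := other b a ne_ba _ tb; first by rewrite tpermC.
  by split; rewrite // tpermC.
have [Ka|] := boolP [forall u in K, u a != a].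
  right; exists a; apply/subsetP=> u Ku; apply/imsetP.
  have ua := forall_inP Ka u Ku; exists (u a); first by rewrite !inE.
  by apply: (kcycles2_eq _ _ _ (K2 u Ku) _ ua ua); rewrite (inj_eq perm_inj).
rewrite negb_forall_in => /exists_inP[u Ku]; rewrite negbK => ua.
have ub : u b != b by case: (meet a b u Kab ne_ab Ku); rewrite ?ua.
have uc : u c != c by case: (meet a c u Kac ne_ac Ku); rewrite ?ua.
have Kbc : tperm b c \in K by rewrite -(kcycles2_eq _ _ _ (K2 u Ku) ub uc).
left; apply: leq_trans (_ : #|[set tperm a b; tperm a c; tperm b c]| <= 3).
  apply: subset_leq_card; apply/subsetP=> v Kv; rewrite !inE.
  have v_eq x y vx vy ne_xy := kcycles2_eq v x y (K2 v Kv) vx vy ne_xy.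
  have [va|va] := eqVneq (v a) a.
    have vb : v b != b by case: (meet a b v Kab ne_ab Kv); rewrite ?va ?eqxx.
    have vc : v c != c by case: (meet a c v Kac ne_ac Kv); rewrite ?va ?eqxx.
    by rewrite (v_eq b c) // eqxx orbT.
  case: (meet b c v Kbc ne_bc Kv) => [vb|vc].
    by rewrite (v_eq a b) // eqxx.
  by rewrite (v_eq a c) // eqxx orbT.
rewrite -setUA; apply: leq_trans (leq_card_setU _ _) _.
by rewrite cards1 cards2; case: (_ != _).
Qed.

End Stars.

Theorem theorem2p3 (n : nat) (hn : 5 <= n) :
  maximum_clique (induced (birkhoff_graph n) (kcycles n 2)) (T1 n) /\
  (forall K : {set 'S_n},
     maximum_clique (induced (birkhoff_graph n) (kcycles n 2)) K ->
     perm_similar (T1 n) K).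
Proof.
have lt_last : n.-1 < n by case: n hn.
have gt3 : 3 < n.-1 by case: n hn {lt_last}.
have T1E := T1_star n (Ordinal lt_last) erefl.
set m := Ordinal lt_last in T1E.
split=> [|K [cliqueK maxK]].
  split=> [|L cliqueL]; first by rewrite T1E; apply: star_clique.
  rewrite T1E card_star.
  have [le3|[c /subset_leq_card]] := clique2_dichotomy n L cliqueL.
    exact: leq_trans le3 (ltnW gt3).
  by rewrite card_star.
have := maxK _ (star_clique n m); rewrite card_star => geK.
have [le3|[c sKc]] := clique2_dichotomy n K cliqueK.
  by have := leq_trans gt3 (leq_trans geK le3).
have -> : K = star n c by apply/eqP; rewrite eqEcard sKc card_star.
exists (tperm c m); rewrite T1E -(conj_star n (tperm c m) c).
by rewrite tpermL.
Qed.
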